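(* Let $R$ be a ring and let $M_R$ be an injective right $R$-module. If the endomorphism ring $S=\mathrm{End}(M_R)$ of $M_R$ is either left quasi-duo or right quasi-duo, then $M_R$ is square-free.
   Context: Rings are associative with identity (not necessarily commutative) and modules are right modules. Endomorphisms of $M_R$ are written on the left, so multiplication in $\mathrm{End}(M_R)$ is composition $(fg)(x)=f(g(x))$. An injective module $M_R$ is called square-free if it contains no direct summand isomorphic to $X\oplus X$ for some nonzero direct summand $X$ of $M_R$; i.e. there is no direct summand $X\neq 0$ of $M_R$ such that $X\oplus X$ is isomorphic to a direct summand of $M_R$. A ring $S$ is called left quasi-duo (resp. right quasi-duo) if every maximal left ideal (resp. every maximal right ideal) of $S$ is a two-sided ideal. *)

(* Defs.v *)
From HB Require Import structures.
From mathcomp Require Import all_boot all_algebra.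
From mathcomp Require Import boolp classical_sets.

Set Implicit Arguments.
Unset Strict Implicit.
Unset Printing Implicit Defensive.

Import GRing.Theory.

Local Open Scope classical_set_scope.
Local Open Scope ring_scope.

(* Rings are [pzRingType]s: noncommutative, and possibly zero, as the
   endomorphism ring of the zero module is.  The module notions below are
   stated for [lmodType]s; a right [R]-module is an [lmodType R^c], where
   [a *: x] stands for x a, so that [a *: (b *: x) = (b * a : R) *: x]. *)

Section Ideals.
Variable S : pzRingType.
Implicit Types I J : set S.

Definition left_ideal I :=
  [/\ I 0, forall x y, I x -> I y -> I (x - y) & forall a x, I x -> I (a * x)].

Definition right_ideal I :=
  [/\ I 0, forall x y, I x -> I y -> I (x - y) & forall a x, I x -> I (x * a)].

Definition two_sided_ideal I := left_ideal I /\ right_ideal I.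

Definition maximal_left_ideal I :=
  [/\ left_ideal I, I <> setT &
      forall J, left_ideal J -> I `<=` J -> J = I \/ J = setT].

Definition maximal_right_ideal I :=
  [/\ right_ideal I, I <> setT &
      forall J, right_ideal J -> I `<=` J -> J = I \/ J = setT].

End Ideals.

Definition left_quasi_duo (S : pzRingType) :=
  forall I : set S, maximal_left_ideal I -> two_sided_ideal I.

Definition right_quasi_duo (S : pzRingType) :=
  forall I : set S, maximal_right_ideal I -> two_sided_ideal I.

Definition endo (R : pzRingType) (M : lmodType R) := {linear M -> M}.

Section EndoRing.
Variables (R : pzRingType) (M : lmodType R).
Implicit Types f g h : endo M.

HB.instance Definition _ := gen_eqMixin (endo M).
HB.instance Definition _ := gen_choiceMixin (endo M).

Lemma endo_ext f g : f =1 g -> f = g.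
Proof.
case: f g => f fL [g gL] /= /funext fg; rewrite -{g}fg in gL *.
case: fL gL => [[fD] [fZ]] [[gD] [gZ]].
by rewrite (Prop_irrelevance gD fD) (Prop_irrelevance gZ fZ).
Qed.

Definition endo0 : endo M := \0 : {linear M -> M}.
Definition endo1 : endo M := idfun : {linear M -> M}.
Definition endoN f : endo M := (\- f) : {linear M -> M}.
Definition endoD f g : endo M := (f \+ g) : {linear M -> M}.
Definition endoM f g : endo M := (f \o g) : {linear M -> M}.

Fact endoDA : associative endoD.
Proof. by move=> f g h; apply: endo_ext => x /=; rewrite addrA. Qed.
Fact endoDC : commutative endoD.
Proof. by move=> f g; apply: endo_ext => x /=; rewrite addrC. Qed.
Fact endo0D : left_id endo0 endoD.
Proof. by move=> f; apply: endo_ext => x /=; rewrite add0r. Qed.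
Fact endoND : left_inverse endo0 endoN endoD.
Proof. by move=> f; apply: endo_ext => x /=; rewrite addNr. Qed.

HB.instance Definition _ :=
  GRing.isZmodule.Build (endo M) endoDA endoDC endo0D endoND.

Fact endoMA : associative endoM.
Proof. by move=> f g h; apply: endo_ext. Qed.
Fact endo1M : left_id endo1 endoM.
Proof. by move=> f; apply: endo_ext. Qed.
Fact endoM1 : right_id endo1 endoM.
Proof. by move=> f; apply: endo_ext. Qed.
Fact endoMDl : left_distributive endoM +%R.
Proof. by move=> f g h; apply: endo_ext. Qed.
Fact endoMDr : right_distributive endoM +%R.
Proof. by move=> f g h; apply: endo_ext => x /=; rewrite raddfD. Qed.

HB.instance Definition _ :=
  GRing.Zmodule_isPzRing.Build (endo M) endoMA endo1M endoM1 endoMDl endoMDr.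

Lemma endo_mulE f g x : (f * g) x = f (g x).
Proof. by []. Qed.

End EndoRing.

Definition injective_module (R : pzRingType) (M : lmodType R) :=
  forall (A B : lmodType R) (i : {linear A -> B}) (g : {linear A -> M}),
    injective i -> exists h : {linear B -> M}, forall a, h (i a) = g a.

Definition isomorphic (R : pzRingType) (U V : lmodType R) :=
  exists f : {linear U -> V}, bijective f.

(* A [submodClosed M] is a boolean predicate; by [asbool] this covers every
   submodule of [M]. *)
Section Submodules.
Variables (R : pzRingType) (M : lmodType R).

Record submodule (N : submodClosed M) :=
  Submodule { submodule_val : M; _ : submodule_val \in N }.

Variable N : submodClosed M.
HB.instance Definition _ := [isSub for @submodule_val N].
HB.instance Definition _ := [Choice of submodule N by <:].
HB.instance Definition _ := [SubChoice_isSubLmodule of submodule N by <:].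

End Submodules.

Section SquareFree.
Variables (R : pzRingType) (M : lmodType R).

Definition direct_summand (X : submodClosed M) :=
  exists Y : submodClosed M,
    (forall m, exists x y, [/\ x \in X, y \in Y & m = x + y]) /\
    (forall m, m \in X -> m \in Y -> m = 0).

Definition square_free :=
  ~ exists X : submodClosed M,
    [/\ direct_summand X, exists2 x, x \in X & x != 0 &
        exists Y : submodClosed M, direct_summand Y /\
          isomorphic (submodule X * submodule X)%type (submodule Y)].

End SquareFree.

(* Main.v *)
(** In a left quasi-duo ring, let [e = ab] be an idempotent with [(ba)e = 0].
    If [e] were nonzero, the left ideal [S(1 - e)] would be proper, hence
    contained in a maximal left ideal [I], two-sided by hypothesis.  Then
    [ba = ba(1 - e)] lies in [I], so [e = a(ba)b] does too, and [1] lies in [I].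
    The right-handed case is the same statement in the converse ring.
    If [X * X] is isomorphic to a summand of [M] then the matrix units [e12] and
    [e21] of [End(M)] along the two copies of [X] serve as [a] and [b], so
    [e11 = 0] and [X = 0]. *)
Require Import Defs.
From mathcomp Require Import all_boot all_algebra.
From HB Require Import structures.
From mathcomp Require Import boolp classical_sets.

Set Implicit Arguments.
Unset Strict Implicit.
Unset Printing Implicit Defensive.

Import GRing.Theory.

Local Open Scope classical_set_scope.
Local Open Scope ring_scope.

Lemma left_ideal_add (S : pzRingType) (I : set S) x y :
  left_ideal I -> I x -> I y -> I (x + y).
Proof.
move=> [I0 IB _] Ix Iy; rewrite -[y]opprK; apply: (IB _ _ Ix).
by rewrite -[- y]add0r; apply: IB.
Qed.

Lemma proper_left_ideal1 (S : pzRingType) (I : set S) :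
  left_ideal I -> I <> setT -> ~ I 1.
Proof.
move=> [_ _ IM] IT I1; apply: IT; apply/seteqP; split=> // x _.
by rewrite -[x]mulr1; apply: IM.
Qed.

(** Zorn's lemma on the left ideals containing [L] and avoiding [1]: any two elements of the union
    of a chain lie in a common member. *)
Lemma maximal_left_ideal_exists (S : pzRingType) (L : set S) :
  left_ideal L -> ~ L 1 -> exists2 I, maximal_left_ideal I & L `<=` I.
Proof.
move=> idL L1.
(* The empty set is allowed so that the empty chain has its union in [P]. *)
pose P (J : set S) := J = set0 \/ [/\ left_ideal J, ~ J 1 & L `<=` J].
have [|I [PI maxI]] := @Zorn_bigcup S P.
  move=> F FP totF.
  have [[J0 [FJ0 [x0 J0x0]]]|F0] :=
      pselect (exists J, F J /\ exists x, J x); last first.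
    left; apply/seteqP; split=> // x [J FJ Jx].
    by apply: F0; exists J; split=> //; exists x.
  have idF J x : F J -> J x -> [/\ left_ideal J, ~ J 1 & L `<=` J].
    by move=> FJ Jx; case: (FP _ FJ) => // J_0; rewrite J_0 in Jx.
  right; have [[J00 _ _] _ LJ0] := idF _ _ FJ0 J0x0; split.
  - split.
    + by exists J0.
    + move=> x y [J FJ Jx] [K FK Ky].
      have [[_ JB _] _ _] := idF _ _ FJ Jx.
      have [[_ KB _] _ _] := idF _ _ FK Ky.
      by case: (totF _ _ FJ FK) => sub;
        [exists K => //; apply: KB => //; apply: sub
        |exists J => //; apply: JB => //; apply: sub].
    + move=> a x [J FJ Jx]; exists J => //.
      by have [[_ _ JM] _ _] := idF _ _ FJ Jx; apply: JM.
  - by move=> [J FJ J1]; have [_ /(_ J1)] := idF _ _ FJ J1.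
  - by move=> x Lx; exists J0 => //; apply: LJ0.
have PL : P L by right; split=> // ?.
have [L0 _ _] := idL.
(* The maximal [I] is not empty, since [L] satisfies [P] and contains [0]. *)
case: PI => [I0|[idI I1 LI]].
  have [] := maxI L; last exact: PL.
  split; first by rewrite I0.
  by rewrite I0 => /(_ 0 L0).
exists I => //; split=> //; first by move=> IT; apply: I1; rewrite IT.
move=> J idJ IJ; case: (pselect (J = setT)) => [|JT]; [by right|left].
have J1 := proper_left_ideal1 idJ JT.
apply/seteqP; split=> //; apply: contrapT => nJI.
apply: (maxI J); first by split.
by right; split=> // x Lx; apply/IJ/LI.
Qed.

Lemma left_quasi_duo_idempotent_eq0 (S : pzRingType) (a b : S) :
  left_quasi_duo S -> (a * b) * (a * b) = a * b -> (b * a) * (a * b) = 0 ->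
  a * b = 0.
Proof.
move=> lqd; set e := a * b => ee fe; apply: contrapT => e0.
pose L := [set s * (1 - e) | s in [set: S]].
have idL : left_ideal L.
  split.
  - by exists 0; rewrite ?mul0r.
  - by move=> _ _ [s _ <-] [t _ <-]; exists (s - t); rewrite ?mulrBl.
  - by move=> t _ [s _ <-]; exists (t * s); rewrite ?mulrA.
have L1 : ~ L 1.
  (* Multiplying [s * (1 - e) = 1] on the right by [e] gives [e = 0]. *)
  move=> [s _ s1]; apply: e0.
  by rewrite -[LHS]mul1r -s1 -mulrA mulrBl mul1r ee subrr mulr0.
have [I maxI LI] := maximal_left_ideal_exists idL L1.
have [idI [_ _ IMr]] := lqd _ maxI.
have [_ IT _] := maxI.
have [_ _ IMl] := idI.
have If : I (b * a).
  by apply: LI; exists (b * a) => //; rewrite mulrBr mulr1 fe subr0.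
have Ie : I e by rewrite -ee /e -mulrA (mulrA b); apply/IMl/IMr.
apply: (proper_left_ideal1 idI IT).
rewrite -[1](subrK e); apply: left_ideal_add => //.
by apply: LI; exists 1; rewrite ?mul1r.
Qed.

(** Left ideals of [S^c] are right ideals of [S] by conversion; only the two halves of two-sidedness
    get swapped. *)
Lemma right_quasi_duo_converse (S : pzRingType) :
  right_quasi_duo S -> left_quasi_duo S^c.
Proof. by move=> rqd I /rqd[]. Qed.

Lemma right_quasi_duo_idempotent_eq0 (S : pzRingType) (a b : S) :
  right_quasi_duo S -> (a * b) * (a * b) = a * b -> (a * b) * (b * a) = 0 ->
  a * b = 0.
Proof.
move=> /right_quasi_duo_converse lqd.
(* The product [b * a] in [S^c] is [a * b] in [S], hence the exchange of [a] and [b]. *)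
exact: (@left_quasi_duo_idempotent_eq0 _ (b : S^c) (a : S^c) lqd).
Qed.

(* [rpredB] does not apply: [submodClosed] also covers semimodules, so it does
   not provide closure under opposites. *)
Lemma submodule_rpredB (R : pzRingType) (M : lmodType R) (X : submodClosed M) :
  {in X &, forall u v, u - v \in X}.
Proof. by have [] := GRing.submod_closedB (submodClosedP X). Qed.

Lemma direct_summand_retraction (R : pzRingType) (M : lmodType R)
    (Y : submodClosed M) :
  direct_summand Y ->
  exists p : {linear M -> submodule Y}, cancel (\val : submodule Y -> M) p.
Proof.
move=> [Z [YZ YZ0]].
have /choice[p pZ] : forall m, exists y : submodule Y, m - \val y \in Z.
  move=> m; have [y [z [Yy Zz ->]]] := YZ m.
  by exists (Sub y Yy); rewrite SubK addrC addKr.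
(* As [Y] and [Z] meet in [0], membership in [Z] determines the component in [Y]; linearity and the
   retraction property both follow. *)
have p_uniq m (y : submodule Y) : m - \val y \in Z -> p m = y.
  move=> Zy; apply: val_inj; apply/eqP; rewrite -subr_eq0; apply/eqP/YZ0.
    by apply: submodule_rpredB; apply: valP.
  have -> : \val (p m) - \val y = (m - \val y) - (m - \val (p m)).
    by rewrite opprB [RHS]addrC addrA subrK.
  by rewrite submodule_rpredB.
have plin : linear p.
  move=> c u v; apply: p_uniq.
  rewrite (linearP (\val : submodule Y -> M)) opprD addrACA -scalerBr.
  by rewrite rpredD // rpredZ.
pose pL : {linear M -> submodule Y} :=
  HB.pack p (GRing.isLinear.Build _ _ _ _ p plin).
exists pL.
by move=> y /=; apply: p_uniq; rewrite subrr rpred0.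
Qed.

(** The injections of [X] into [X * X] are carried into [M] through [Y]; the maps back retract [M]
    onto [Y], then project. *)
Lemma square_summand_maps (R : pzRingType) (M X : lmodType R)
    (Y : submodClosed M) :
  direct_summand Y -> isomorphic (X * X)%type (submodule Y) ->
  exists (i1 i2 : {linear X -> M}) (r1 r2 : {linear M -> X}),
    [/\ cancel i1 r1, cancel i2 r2, forall x, r1 (i2 x) = 0 &
        forall x, r2 (i1 x) = 0].
Proof.
move=> /direct_summand_retraction[p pK] [f [g fK gK]].
have glin : linear g by exact: can2_linear gK.
pose gL : {linear submodule Y -> (X * X)%type} :=
  HB.pack g (GRing.isLinear.Build _ _ _ _ g glin).
have lin1 : linear (fun x : X => (x, 0 : X)).
  by move=> c u v; congr pair; rewrite /= scaler0 addr0.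
have lin2 : linear (fun x : X => (0 : X, x)).
  by move=> c u v; congr pair; rewrite /= scaler0 addr0.
pose j1 : {linear X -> (X * X)%type} :=
  HB.pack (fun x : X => (x, 0 : X)) (GRing.isLinear.Build _ _ _ _ _ lin1).
pose j2 : {linear X -> (X * X)%type} :=
  HB.pack (fun x : X => (0 : X, x)) (GRing.isLinear.Build _ _ _ _ _ lin2).
exists ((\val : submodule Y -> M) \o (f \o j1)).
exists ((\val : submodule Y -> M) \o (f \o j2)).
exists (fst \o (gL \o p)), (snd \o (gL \o p)).
by split=> x /=; rewrite pK fK.
Qed.

Theorem theorem2p1 (R : pzRingType) (M : lmodType R^c) :
  injective_module M ->
  left_quasi_duo (endo M) \/ right_quasi_duo (endo M) ->
  square_free M.
Proof.
move=> _ qd [X [_ [x Xx x0] [Y [sY isoY]]]].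
have [i1 [i2 [r1 [r2 [i1K i2K r1i2 r2i1]]]]] := square_summand_maps sY isoY.
(* Here [a * b] is [i1 \o r1] and [b * a] is [i2 \o r2], two orthogonal idempotents. *)
pose a : endo M := (i1 \o r2 : {linear M -> M}).
pose b : endo M := (i2 \o r1 : {linear M -> M}).
have ee : (a * b) * (a * b) = a * b.
  by apply: endo_ext => m; rewrite !endo_mulE /= !i2K i1K.
have fe : (b * a) * (a * b) = 0.
  by apply: endo_ext => m; rewrite !endo_mulE /= r2i1 !linear0.
have ef : (a * b) * (b * a) = 0.
  by apply: endo_ext => m; rewrite !endo_mulE /= r1i2 !linear0.
have e0 : a * b = 0.
  case: qd => qd; first exact: left_quasi_duo_idempotent_eq0.
  exact: right_quasi_duo_idempotent_eq0.
pose u : submodule X := Sub x Xx.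
(* The idempotent [a * b] fixes the image of [i1]. *)
have i1u0 : i1 u = 0.
  by have := congr1 (fun h : endo M => h (i1 u)) e0; rewrite !endo_mulE /= i2K i1K.
move/eqP: x0; apply; have := i1K u; rewrite i1u0 linear0 => /(congr1 \val).
by rewrite linear0 SubK.
Qed.
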